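(* Let $X_i \subset \mathbb R^{n_i}$, $i = 1,2$, be regular convex sets, and let $f_i$ be projectively self-concordant barriers on $X_i$ with parameters $\gamma_i = \frac{\nu_i-2}{\sqrt{\nu_i-1}}$, $\nu_i\ge2$, respectively. Then $f(x,y) = \frac{\nu_1f_1(x) + \nu_2f_2(y)}{\nu_1+\nu_2}$ is a projectively self-concordant barrier on the set $X = X_1 \times X_2$ with parameter $\gamma = \frac{\nu_1+\nu_2-2}{\sqrt{\nu_1+\nu_2-1}}$.
   Context: A regular convex set $X \subset \mathbb R^n$ is a closed convex set with non-empty interior $X^o$ containing no lines; $\partial X$ is its boundary. A projectively self-concordant barrier on $X$ with parameter $\gamma \geq 0$ is a $C^3$ function $f: X^o \to \mathbb R$ such that: (1) $f''(x) - f'(x)f'(x)^T \succ 0$ (positive definite) for all $x \in X^o$; (2) $\lim_{x \to\partial X} f(x) = +\infty$, i.e. $f(x_k)\to+\infty$ whenever $x_k \in X^o$ converges to a point of $\partial X$; (3) $|f'''(x)[h,h,h] - 6f''(x)[h,h]f'(x)[h] + 4(f'(x)[h])^3| \leq 2\gamma(f''(x)[h,h] - (f'(x)[h])^2)^{3/2}$ for all $x \in X^o$, $h \in \mathbb R^n$. *)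

(* Defs.v *)
From HB Require Import structures.
From mathcomp Require Import all_boot all_order all_algebra.
From mathcomp Require Import all_classical all_reals all_analysis.

Set Implicit Arguments.
Unset Strict Implicit.
Unset Printing Implicit Defensive.

Import Order.TTheory GRing.Theory Num.Theory.
Import numFieldNormedType.Exports.

Local Open Scope classical_set_scope.
Local Open Scope ring_scope.

(* Points of R^n are column vectors. A function on the interior of X is
   represented by a total function of which only the values on the interior of X
   matter: all derivatives below are taken at interior points. *)

Definition boundary (T : topologicalType) (X : set T) : set T :=
  closure X `\` interior X.

Record regular_convex (R : realType) (n : nat) (X : set 'cV[R]_n) : Prop := {
  regular_closed : closed X;
  regular_convex_set : convex_set (M := 'cV[R]_n) X;
  regular_interior : interior X !=set0;
  regular_no_line : ~ exists p v : 'cV[R]_n, v != 0 /\ forall t : R, X (p + t *: v)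
}.

(* C^k on an open set U: in finite dimension, f' is C^k if and only if all the
   directional derivatives x |-> f'(x)[v] are. *)
Fixpoint Ck (R : realType) (n k : nat) (U : set 'cV[R]_n) (f : 'cV[R]_n -> R)
    : Prop :=
  match k with
  | 0 => forall x, U x -> {for x, continuous f}
  | k'.+1 => (forall x, U x -> differentiable f x) /\
             forall v : 'cV[R]_n, Ck k' U ('D_v f)
  end.

Definition gradient (R : realType) (n : nat) (f : 'cV[R]_n -> R) (x : 'cV[R]_n)
    : 'cV[R]_n :=
  \col_i 'D_(delta_mx i 0) f x.

Definition hessian (R : realType) (n : nat) (f : 'cV[R]_n -> R) (x : 'cV[R]_n)
    : 'M[R]_n :=
  \matrix_(i, j) 'D_(delta_mx i 0) ('D_(delta_mx j 0) f) x.

Definition posdefmx (R : realType) (n : nat) (A : 'M[R]_n) : Prop :=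
  A^T = A /\ forall h : 'cV[R]_n, h != 0 -> 0 < (h^T *m A *m h) 0 0.

(* For the functions considered, f'(x)[h], f''(x)[h,h] and f'''(x)[h,h,h] are
   the iterated directional derivatives of f along h. *)
Definition D1 (R : realType) (n : nat) (f : 'cV[R]_n -> R) (x h : 'cV[R]_n) : R :=
  'D_h f x.
Definition D2 (R : realType) (n : nat) (f : 'cV[R]_n -> R) (x h : 'cV[R]_n) : R :=
  'D_h ('D_h f) x.
Definition D3 (R : realType) (n : nat) (f : 'cV[R]_n -> R) (x h : 'cV[R]_n) : R :=
  'D_h ('D_h ('D_h f)) x.

(* A barrier is only defined on a regular convex set and for gamma >= 0, so both
   conditions are part of the notion. *)
Record psc_barrier (R : realType) (n : nat) (X : set 'cV[R]_n) (gamma : R)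
    (f : 'cV[R]_n -> R) : Prop := {
  psc_regular : regular_convex X;
  psc_param : 0 <= gamma;
  psc_C3 : Ck 3 (interior X) f;
  psc_posdef : forall x : 'cV[R]_n, interior X x ->
    posdefmx (hessian f x - gradient f x *m (gradient f x)^T);
  psc_boundary : forall (u : nat -> 'cV[R]_n) (p : 'cV[R]_n),
    (forall k, interior X (u k)) -> boundary X p ->
    u k @[k --> \oo] --> p -> f (u k) @[k --> \oo] --> +oo;
  psc_ineq : forall x h : 'cV[R]_n, interior X x ->
    `| D3 f x h - 6 * D2 f x h * D1 f x h + 4 * D1 f x h ^+ 3 |
      <= 2 * gamma * (D2 f x h - D1 f x h ^+ 2) `^ (3 / 2)
}.

Definition prod_set (R : realType) (n1 n2 : nat) (X1 : set 'cV[R]_n1)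
    (X2 : set 'cV[R]_n2) : set 'cV[R]_(n1 + n2) :=
  [set z | X1 (usubmx z) /\ X2 (dsubmx z)].

(* Main.v *)
(** With weights [w_i = nu_i / (nu1 + nu2)] and [d = a1 - a2] the difference of
the two directional derivatives, the quadratic forms [P = f'' - f' f'] satisfy
[P = w1 P1 + w2 P2 + w1 w2 d^2], and half of the cubic form of the barrier is
[e = w1 e1 + w2 e2 + 3 w1 w2 d (P1 - P2) + w1 w2 (w2 - w1) d^3], where [e_i] is
half of the cubic form of [f_i].  To bound [e], add a radial component [r] to the
direction, as in the cone over [X1 * X2]: with [p^2 = P], [p_i^2 = P_i],
[r1 = r + w2 d] and [r2 = r - w1 d], the form [e + 3 p^2 r + r^3] is exactly the
[w]-average of the forms [e_i + 3 p_i^2 r_i + r_i^3].  With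
[s_i = sqrt (nu_i - 1)], each of these is at most
[(p_i^2 + r_i^2) (s_i p_i + r_i)], and by Cauchy-Schwarz
[s_i p_i + r_i <= sqrt (nu_i (p_i^2 + r_i^2)) <= sqrt ((nu1 + nu2) (p^2 + r^2))].
Choosing [r = p / s] with [s = sqrt (nu1 + nu2 - 1)] yields [e <= (s - 1/s) p^3],
which is the claimed constant. *)

Require Import Defs.
From mathcomp Require Import all_boot all_order all_algebra.
From mathcomp Require Import ring lra.
From mathcomp Require Import all_classical all_reals all_analysis.
Import Order.TTheory GRing.Theory Num.Theory.
Import numFieldNormedType.Exports.
Local Open Scope classical_set_scope.
Local Open Scope ring_scope.

Set Implicit Arguments.
Unset Strict Implicit.
Unset Printing Implicit Defensive.

(** * Cubic inequalities over a real field *)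

(** With [e] at its upper bound, the right side minus the left side is the nonnegative quantity
    [p / s * (p - s * r) ^+ 2]. It vanishes at [r = p / s], so at that [r] the inequality gives back
    the bound on [e]. *)
Lemma cubic_section_le (R : realFieldType) (s p r e : R) :
  0 < s -> 0 <= p -> e <= (s - s^-1) * p ^+ 3 ->
  e + 3 * p ^+ 2 * r + r ^+ 3 <= (p ^+ 2 + r ^+ 2) * (s * p + r).
Proof.
move=> s0 p0 ep.
have : 0 <= p / s * (p - s * r) ^+ 2.
  by rewrite mulr_ge0 ?sqr_ge0// divr_ge0// ltW.
have -> : p / s * (p - s * r) ^+ 2 = (p ^+ 2 + r ^+ 2) * (s * p + r)
    - ((s - s^-1) * p ^+ 3 + 3 * p ^+ 2 * r + r ^+ 3).
  by field; rewrite gt_eqF.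
by lra.
Qed.

(** Cauchy-Schwarz for the vectors [(s, 1)] and [(p, r)], whose defect is [(p - s * r) ^+ 2]. *)
Lemma linear_le_of_sqr_le (R : realFieldType) (s p r q : R) :
  0 <= q -> (s ^+ 2 + 1) * (p ^+ 2 + r ^+ 2) <= q ^+ 2 -> s * p + r <= q.
Proof.
move=> q0 hq.
rewrite real_leNgt ?num_real//; apply/negP => hlt.
have := sqr_ge0 (p - s * r).
have : q ^+ 2 < (s * p + r) ^+ 2.
  by rewrite ltr_pXn2r// nnegrE// ltW// (le_lt_trans q0).
by nra.
Qed.

(** Here [s_i ^+ 2 + 1] plays the role of [nu_i] and [s ^+ 2 + 1] that of [nu1 + nu2], so the
    hypotheses on [w1] and [w2] express the weights without division. *)
Lemma cubic_product_le (R : realFieldType) (w1 w2 s1 s2 s p1 p2 p d e1 e2 : R) :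
  0 <= w1 -> 0 <= w2 -> w1 + w2 = 1 -> 0 < s1 -> 0 < s2 -> 0 < s ->
  w1 * (s ^+ 2 + 1) = s1 ^+ 2 + 1 -> w2 * (s ^+ 2 + 1) = s2 ^+ 2 + 1 ->
  0 <= p1 -> 0 <= p2 -> 0 <= p ->
  p ^+ 2 = w1 * p1 ^+ 2 + w2 * p2 ^+ 2 + w1 * w2 * d ^+ 2 ->
  e1 <= (s1 - s1^-1) * p1 ^+ 3 -> e2 <= (s2 - s2^-1) * p2 ^+ 3 ->
  w1 * e1 + w2 * e2 + 3 * (w1 * w2 * d * (p1 ^+ 2 - p2 ^+ 2))
    + w1 * w2 * (w2 - w1) * d ^+ 3 <= (s - s^-1) * p ^+ 3.
Proof.
move=> w10 w20 w12 s10 s20 s0 ws1 ws2 p10 p20 p0 pE e1p e2p.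
(* This [r] is the equality case of [cubic_section_le] for [p] and [s]. For it, [q] below equals
   [s * p + r], and [q ^+ 2] equals [(s ^+ 2 + 1) * (p ^+ 2 + r ^+ 2)]. *)
pose r := p / s; pose r1 := r + w2 * d; pose r2 := r - w1 * d.
pose q := (s ^+ 2 + 1) * r.
have q0 : 0 <= q.
  by rewrite mulr_ge0 ?addr_ge0 ?sqr_ge0// divr_ge0// ltW.
(* The shifts in [r1] and [r2] have weighted mean zero and weighted variance [w1 * w2 * d ^+ 2], so
   [p ^+ 2 + r ^+ 2] is the weighted mean of the [p_i ^+ 2 + r_i ^+ 2]. Both summands being
   nonnegative, each is at most [q ^+ 2], which yields [l1] and [l2]. *)
have qE : (s1 ^+ 2 + 1) * (p1 ^+ 2 + r1 ^+ 2)
        + (s2 ^+ 2 + 1) * (p2 ^+ 2 + r2 ^+ 2) = q ^+ 2.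
  have psr : p = s * r by rewrite /r; field; rewrite gt_eqF.
  have w2E : w2 = 1 - w1 by rewrite -w12 addrC addKr.
  transitivity ((s ^+ 2 + 1) * (p ^+ 2 + r ^+ 2)); last by rewrite psr /q; ring.
  by rewrite -ws1 -ws2 pE /r1 /r2 w2E; ring.
have nn (x y z : R) : 0 <= (x ^+ 2 + 1) * (y ^+ 2 + z ^+ 2).
  by rewrite mulr_ge0 ?addr_ge0 ?sqr_ge0.
have l1 : s1 * p1 + r1 <= q by apply: linear_le_of_sqr_le; rewrite // -qE lerDl.
have l2 : s2 * p2 + r2 <= q by apply: linear_le_of_sqr_le; rewrite // -qE lerDr.
have c1 := @cubic_section_le R s1 p1 r1 e1 s10 p10 e1p.
have c2 := @cubic_section_le R s2 p2 r2 e2 s20 p20 e2p.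
have {}c1 : e1 + 3 * p1 ^+ 2 * r1 + r1 ^+ 3 <= (p1 ^+ 2 + r1 ^+ 2) * q.
  by rewrite (le_trans c1)// ler_wpM2l// addr_ge0 ?sqr_ge0.
have {}c2 : e2 + 3 * p2 ^+ 2 * r2 + r2 ^+ 3 <= (p2 ^+ 2 + r2 ^+ 2) * q.
  by rewrite (le_trans c2)// ler_wpM2l// addr_ge0 ?sqr_ge0.
have {c1 c2} := lerD (ler_wpM2l w10 c1) (ler_wpM2l w20 c2).
have w2E : w2 = 1 - w1 by rewrite -w12 addrC addKr.
(* The averaged inequality and the goal have the same difference of sides, so a polynomial identity
   finishes. *)
rewrite -subr_ge0 => h; rewrite -subr_ge0; move: h.
congr (0 <= _).
have -> : (s - s^-1) * p ^+ 3 = (p ^+ 2 + r ^+ 2) * q - 3 * p ^+ 2 * r - r ^+ 3.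
  by rewrite /q /r; field; rewrite gt_eqF.
by rewrite pE /r1 /r2 w2E; ring.
Qed.

(** The cubic expression is odd in [(d, e1, e2)], which change sign together when the direction is
    reversed. The lower bound is thus the upper bound at the negated arguments. *)
Lemma cubic_product_norm_le (R : realFieldType)
    (w1 w2 s1 s2 s p1 p2 p d e1 e2 : R) :
  0 <= w1 -> 0 <= w2 -> w1 + w2 = 1 -> 0 < s1 -> 0 < s2 -> 0 < s ->
  w1 * (s ^+ 2 + 1) = s1 ^+ 2 + 1 -> w2 * (s ^+ 2 + 1) = s2 ^+ 2 + 1 ->
  0 <= p1 -> 0 <= p2 -> 0 <= p ->
  p ^+ 2 = w1 * p1 ^+ 2 + w2 * p2 ^+ 2 + w1 * w2 * d ^+ 2 ->
  `|e1| <= (s1 - s1^-1) * p1 ^+ 3 -> `|e2| <= (s2 - s2^-1) * p2 ^+ 3 ->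
  `|w1 * e1 + w2 * e2 + 3 * (w1 * w2 * d * (p1 ^+ 2 - p2 ^+ 2))
    + w1 * w2 * (w2 - w1) * d ^+ 3| <= (s - s^-1) * p ^+ 3.
Proof.
move=> w10 w20 w12 s10 s20 s0 ws1 ws2 p10 p20 p0 pE.
rewrite !ler_norml => /andP[e1l e1u] /andP[e2l e2u].
apply/andP; split; last exact: (@cubic_product_le _ _ _ s1 s2).
rewrite lerNl.
have := @cubic_product_le R w1 w2 s1 s2 s p1 p2 p (- d) (- e1) (- e2).
rewrite sqrrN [- e1 <= _]lerNl [- e2 <= _]lerNl.
move=> /(_ w10 w20 w12 s10 s20 s0 ws1 ws2 p10 p20 p0 pE e1l e2l); apply: le_trans.
by rewrite le_eqVlt; apply/orP; left; apply/eqP; ring.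
Qed.

(** * Differentiability under local equality and linear substitution *)

(** The first-order expansion of [f] at [x] is also one of [g], and uniqueness of the differential
    identifies ['d g x] with ['d f x]. *)
Lemma near_eq_differentiable (R : numFieldType) (V W : normedModType R)
    (f g : V -> W) (x : V) :
  {near x, f =1 g} -> differentiable f x -> differentiable g x.
Proof.
move=> fg df; have fgx : f x = g x := nbhs_singleton fg.
have dc : continuous ('d f x) := diff_continuous df.
have gE : g \o shift x = cst (g x) + 'd f x +o_ 0 id.
  apply/eqaddoP => e e0.
  have fg0 := fg; rewrite (near_shift 0) /= subr0 in fg0.
  have /eqaddoP/(_ e e0) := diff_locally df; apply: filterS2 fg0 => h /= fgh.
  by rewrite !fctE /= -fgh -fgx.
apply/diff_locallyP; have -> : 'd g x = 'd f x :> (V -> W) := diff_unique dc gE.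
by split.
Qed.

(** Openness of [U] turns equality on [U] into equality near each of its points, so the directional
    derivatives agree on [U] too and the induction continues. *)
Lemma Ck_ext (R : realType) (n k : nat) (U : set 'cV[R]_n) (f g : 'cV[R]_n -> R) :
  open U -> (forall x, U x -> f x = g x) -> Ck k U f -> Ck k U g.
Proof.
move=> oU; elim: k f g => [|k IH] f g fg /=.
  move=> fc x Ux; have fgx : \forall y \near x, f y = g y.
    by near=> y; apply: fg; near: y; exact: open_nbhs_nbhs.
  rewrite /prop_for /continuous_at -(fg x Ux); apply: cvg_trans (fc x Ux).
  exact: (near_eq_cvg fgx).
case=> df dDf; have fgx x : U x -> \forall y \near x, f y = g y.
  by move=> Ux; near=> y; apply: fg; near: y; exact: open_nbhs_nbhs.
split=> [x Ux|v]; first exact: (near_eq_differentiable (fgx x Ux) (df x Ux)).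
apply: IH (dDf v) => x Ux; exact: near_eq_derive (fgx x Ux).
Unshelve. all: by end_near. Qed.

(** The two difference quotients coincide by linearity of [L], before any limit is taken. *)
Lemma derive_comp_linear (R : numFieldType) (V V' W : normedModType R)
    (L : {linear V -> V'}) (f : V' -> W) (v x : V) :
  'D_v (f \o L) x = 'D_(L v) f (L x).
Proof.
rewrite /derive /=; congr (lim _).
by under eq_fun do rewrite linearP.
Qed.

(** * Topology and convexity of the product set *)

Lemma continuous_usubmx (R : numFieldType) (m1 m2 n : nat) :
  continuous (usubmx : 'M[R]_(m1 + m2, n) -> 'M[R]_(m1, n)).
Proof.
move=> u A /nbhs_ballP[e /= e0 eA].
apply/nbhs_ballP; exists e => //= v [_ uv]; apply: eA; split => // i j.
by apply: (le_lt_trans _ (uv (lshift m2 i) j)); rewrite !mxE.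
Qed.

Lemma continuous_dsubmx (R : numFieldType) (m1 m2 n : nat) :
  continuous (dsubmx : 'M[R]_(m1 + m2, n) -> 'M[R]_(m2, n)).
Proof.
move=> u A /nbhs_ballP[e /= e0 eA].
apply/nbhs_ballP; exists e => //= v [_ uv]; apply: eA; split => // i j.
by apply: (le_lt_trans _ (uv (rshift m1 i) j)); rewrite !mxE.
Qed.

Lemma continuous_col_mxl (R : numFieldType) (m1 m2 n : nat) (B : 'M[R]_(m2, n)) :
  continuous (fun A : 'M[R]_(m1, n) => col_mx A B).
Proof.
move=> u A /nbhs_ballP[e /= e0 eA].
apply/nbhs_ballP; exists e => //= v [_ uv]; apply: eA; split => // i j.
rewrite !mxE; case: (fintype.split i) => k; first exact: uv.
exact: ballxx.
Qed.

Lemma continuous_col_mxr (R : numFieldType) (m1 m2 n : nat) (A : 'M[R]_(m1, n)) :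
  continuous (fun B : 'M[R]_(m2, n) => col_mx A B).
Proof.
move=> u C /nbhs_ballP[e /= e0 eC].
apply/nbhs_ballP; exists e => //= v [_ uv]; apply: eC; split => // i j.
rewrite !mxE; case: (fintype.split i) => k; last exact: uv.
exact: ballxx.
Qed.

Lemma interior_prod_set (R : realType) (n1 n2 : nat) (X1 : set 'cV[R]_n1)
    (X2 : set 'cV[R]_n2) :
  interior (prod_set X1 X2) = prod_set (interior X1) (interior X2).
Proof.
apply/seteqP; split=> z /=; rewrite /interior /prod_set /=; last first.
  move=> [/(@continuous_usubmx _ _ _ _ z) h1
          /(@continuous_dsubmx _ _ _ _ z) h2].
  exact: (@filterI _ (nbhs z) _ _ _ h1 h2).
(* For the projections of an interior point [z], pull the neighbourhood back along the slice through
   [z] on which the other block is fixed. *)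
move=> h; split.
  have := @continuous_col_mxl R n1 n2 1 (dsubmx z) (usubmx z) (prod_set X1 X2).
  rewrite vsubmxK => /(_ h); rewrite !nbhs_simpl /=; apply: filterS => y [] /=.
  by rewrite col_mxKu.
have := @continuous_col_mxr R n1 n2 1 (usubmx z) (dsubmx z) (prod_set X1 X2).
rewrite vsubmxK => /(_ h); rewrite !nbhs_simpl /=; apply: filterS => y [] /=.
by rewrite col_mxKd.
Qed.

Lemma open_prod_set (R : realType) (n1 n2 : nat) (U1 : set 'cV[R]_n1)
    (U2 : set 'cV[R]_n2) : open U1 -> open U2 -> open (prod_set U1 U2).
Proof.
move=> /interior_id U1E /interior_id U2E.
by rewrite -U1E -U2E -interior_prod_set; exact: open_interior.
Qed.

Lemma regular_convex_prod_set (R : realType) (n1 n2 : nat) (X1 : set 'cV[R]_n1)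
    (X2 : set 'cV[R]_n2) :
  regular_convex X1 -> regular_convex X2 -> regular_convex (prod_set X1 X2).
Proof.
move=> [cl1 co1 [a1 ia1] nl1] [cl2 co2 [a2 ia2] nl2]; split.
- apply: closedI.
    by apply: (@preimage_closed _ _ usubmx) => // ? _; exact: continuous_usubmx.
  by apply: (@preimage_closed _ _ dsubmx) => // ? _; exact: continuous_dsubmx.
- move=> x y l; rewrite !inE => -[x1 x2] [y1 y2].
  split.
    have := co1 (usubmx x) (usubmx y) l; rewrite !inE => /(_ x1 y1).
    by rewrite /conv /= linearD !linearZ.
  have := co2 (dsubmx x) (dsubmx y) l; rewrite !inE => /(_ x2 y2).
  by rewrite /conv /= linearD !linearZ.
- rewrite interior_prod_set; exists (col_mx a1 a2).
  by rewrite /prod_set/= col_mxKu col_mxKd.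
(* A nonzero direction has a nonzero block, and projecting to that block gives a line in the
   corresponding factor. *)
- move=> [p [v [v0 line]]]; have [v10|v10] := eqVneq (usubmx v) 0; last first.
    apply: nl1; exists (usubmx p), (usubmx v); split => // t.
    by have [] := line t; rewrite linearD linearZ.
  apply: nl2; exists (dsubmx p), (dsubmx v); split => [|t].
    by apply: contra_neq v0 => v20; rewrite -[v]vsubmxK v10 v20 col_mx0.
  by have [] := line t; rewrite !linearD !linearZ.
Qed.

(** * Derivatives of weighted sums of functions of separate blocks *)

(** This shape is stable under directional differentiation with unchanged weights, which lets one
    rule serve for all orders. *)
Definition prod_fun (R : realType) (n1 n2 : nat) (w1 w2 : R)
    (f1 : 'cV[R]_n1 -> R) (f2 : 'cV[R]_n2 -> R) (z : 'cV[R]_(n1 + n2)) : R :=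
  w1 * f1 (usubmx z) + w2 * f2 (dsubmx z).

Lemma prod_funE (R : realType) (n1 n2 : nat) (w1 w2 : R)
    (f1 : 'cV[R]_n1 -> R) (f2 : 'cV[R]_n2 -> R) :
  prod_fun w1 w2 f1 f2 = w1 *: (f1 \o usubmx) + w2 *: (f2 \o dsubmx).
Proof. by []. Qed.

Lemma differentiable_prod_fun (R : realType) (n1 n2 : nat) (w1 w2 : R)
    (f1 : 'cV[R]_n1 -> R) (f2 : 'cV[R]_n2 -> R) (z : 'cV[R]_(n1 + n2)) :
  differentiable f1 (usubmx z) -> differentiable f2 (dsubmx z) ->
  differentiable (prod_fun w1 w2 f1 f2) z.
Proof.
move=> df1 df2; rewrite prod_funE; apply: differentiableD; apply: differentiableZ.
  apply: differentiable_comp df1.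
  by apply: linear_differentiable => ?; exact: continuous_usubmx.
apply: differentiable_comp df2.
by apply: linear_differentiable => ?; exact: continuous_dsubmx.
Qed.

Lemma derive_prod_fun (R : realType) (n1 n2 : nat) (w1 w2 : R)
    (f1 : 'cV[R]_n1 -> R) (f2 : 'cV[R]_n2 -> R) (v z : 'cV[R]_(n1 + n2)) :
  differentiable f1 (usubmx z) -> differentiable f2 (dsubmx z) ->
  'D_v (prod_fun w1 w2 f1 f2) z =
  prod_fun w1 w2 ('D_(usubmx v) f1) ('D_(dsubmx v) f2) z.
Proof.
move=> df1 df2; rewrite prod_funE.
have d1 : derivable (f1 \o usubmx) z v.
  apply: diff_derivable; apply: differentiable_comp df1.
  by apply: linear_differentiable => ?; exact: continuous_usubmx.
have d2 : derivable (f2 \o dsubmx) z v.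
  apply: diff_derivable; apply: differentiable_comp df2.
  by apply: linear_differentiable => ?; exact: continuous_dsubmx.
rewrite deriveD; [|exact: derivableZ|exact: derivableZ].
by rewrite !deriveZ// !derive_comp_linear.
Qed.

(** Equality is assumed and concluded only on the open product, so the conclusion for ['D_v F] feeds
    the hypothesis for the next derivative. *)
Lemma derive_eq_prod_fun (R : realType) (n1 n2 : nat) (w1 w2 : R)
    (U1 : set 'cV[R]_n1) (U2 : set 'cV[R]_n2)
    (f1 : 'cV[R]_n1 -> R) (f2 : 'cV[R]_n2 -> R) (F : 'cV[R]_(n1 + n2) -> R) :
  open U1 -> open U2 ->
  (forall x, U1 x -> differentiable f1 x) ->
  (forall x, U2 x -> differentiable f2 x) ->
  (forall z, prod_set U1 U2 z -> F z = prod_fun w1 w2 f1 f2 z) ->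
  forall v z, prod_set U1 U2 z ->
    'D_v F z = prod_fun w1 w2 ('D_(usubmx v) f1) ('D_(dsubmx v) f2) z.
Proof.
move=> oU1 oU2 df1 df2 FE v z Uz.
rewrite -derive_prod_fun; [|by apply: df1; case: Uz|by apply: df2; case: Uz].
apply: near_eq_derive; near=> y; apply: FE; near: y.
by apply: open_nbhs_nbhs; split => //; exact: open_prod_set.
Unshelve. all: by end_near. Qed.

Lemma Ck_prod_fun (R : realType) (n1 n2 k : nat) (w1 w2 : R)
    (U1 : set 'cV[R]_n1) (U2 : set 'cV[R]_n2)
    (f1 : 'cV[R]_n1 -> R) (f2 : 'cV[R]_n2 -> R) :
  open U1 -> open U2 -> Ck k U1 f1 -> Ck k U2 f2 ->
  Ck k (prod_set U1 U2) (prod_fun w1 w2 f1 f2).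
Proof.
move=> oU1 oU2; elim: k f1 f2 => [|k IH] f1 f2 /=.
  move=> c1 c2 z [Uz1 Uz2].
  have h1 : {for z, continuous (f1 \o usubmx)}.
    exact: (continuous_comp (@continuous_usubmx _ _ _ _ z) (c1 _ Uz1)).
  have h2 : {for z, continuous (f2 \o dsubmx)}.
    exact: (continuous_comp (@continuous_dsubmx _ _ _ _ z) (c2 _ Uz2)).
  exact: (continuousD (continuousZl_tmp (k := w1) h1)
                      (continuousZl_tmp (k := w2) h2)).
move=> [df1 Df1] [df2 Df2]; split => [z [Uz1 Uz2]|v].
  by apply: differentiable_prod_fun; [exact: df1|exact: df2].
apply: Ck_ext (IH _ _ (Df1 (usubmx v)) (Df2 (dsubmx v))).
  exact: open_prod_set.
by move=> z [Uz1 Uz2]; rewrite derive_prod_fun//; [exact: df1|exact: df2].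
Qed.

(** * Gradient and Hessian as linear and quadratic forms *)

Lemma derive_gradient (R : realType) (n : nat) (f : 'cV[R]_n -> R)
    (x v : 'cV[R]_n) :
  differentiable f x -> 'D_v f x = \sum_i v i 0 * 'D_(delta_mx i 0) f x.
Proof.
move=> df; rewrite deriveE// [in LHS](matrix_sum_delta v) linear_sum /=.
apply: eq_bigr => i _; rewrite big_ord1 linearZ /=.
by rewrite deriveE.
Qed.

(** Near [x], ['D_v f] is a combination of the partial derivatives with constant coefficients
    [v j 0]. Differentiating it along [u] and expanding each term by the gradient formula gives the
    bilinear form. *)
Lemma derive2_hessian (R : realType) (n : nat) (U : set 'cV[R]_n)
    (f : 'cV[R]_n -> R) (u v x : 'cV[R]_n) :
  open U -> Ck 2 U f -> U x ->
  'D_u ('D_v f) x = (u^T *m hessian f x *m v) 0 0.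
Proof.
move=> oU [df Df] Ux.
have dDf w : differentiable ('D_w f) x by have [+ _] := Df w; exact.
transitivity ('D_u (\sum_j v j 0 *: ('D_(delta_mx j 0) f)) x).
  apply: near_eq_derive; near=> y.
  rewrite derive_gradient; last first.
    by apply: df; near: y; exact: open_nbhs_nbhs.
  by rewrite fct_sumE.
rewrite derive_sum => [|j]; last by apply: derivableZ; exact: diff_derivable.
rewrite mxE; apply: eq_bigr => j _.
rewrite deriveZ; last exact: diff_derivable.
rewrite mxE [in LHS]derive_gradient// mulrC; congr (_ * _).
by apply: eq_bigr => i _; rewrite !mxE.
Unshelve. all: by end_near. Qed.

(** Translates the matrix condition of a barrier into the scalar quantity that appears in its cubic
    inequality. *)
Lemma quad_hessian_sub_gradient (R : realType) (n : nat) (U : set 'cV[R]_n)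
    (f : 'cV[R]_n -> R) (x h : 'cV[R]_n) :
  open U -> Ck 2 U f -> U x ->
  (h^T *m (hessian f x - gradient f x *m (gradient f x)^T) *m h) 0 0 =
  D2 f x h - D1 f x h ^+ 2.
Proof.
move=> oU cf Ux; rewrite /D2 (derive2_hessian _ _ oU cf Ux).
rewrite mulmxBr mulmxBl mxE; congr (_ + _); rewrite [in LHS]mxE; congr (- _).
rewrite mulmxA -mulmxA mxE big_ord1 expr2.
have hg : (h^T *m gradient f x) 0 0 = D1 f x h.
  rewrite /D1 derive_gradient; last by case: cf => + _; exact.
  by rewrite mxE; apply: eq_bigr => i _; rewrite !mxE.
by rewrite hg -[(gradient f x)^T *m h]trmxK trmx_mul trmxK mxE hg.
Qed.

(** The rank-one term is symmetric, so the assumed symmetry of the difference passes to the Hessian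
    and hence to its bilinear form. *)
Lemma derive2C (R : realType) (n : nat) (U : set 'cV[R]_n)
    (f : 'cV[R]_n -> R) (x : 'cV[R]_n) :
  open U -> Ck 2 U f -> U x ->
  (hessian f x - gradient f x *m (gradient f x)^T)^T
    = hessian f x - gradient f x *m (gradient f x)^T ->
  forall u v, 'D_u ('D_v f) x = 'D_v ('D_u f) x.
Proof.
move=> oU cf Ux; rewrite linearB /= trmx_mul trmxK => /addIr hT u v.
rewrite !(derive2_hessian _ _ oU cf Ux) -[in RHS]hT.
by rewrite -[in RHS](trmxK u) -!trmx_mul mulmxA [in RHS]mxE.
Qed.

Lemma Ck_pred (R : realType) (n k : nat) (U : set 'cV[R]_n) (f : 'cV[R]_n -> R) :
  Ck k.+1 U f -> Ck k U f.
Proof.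
elim: k f => [|k IH] f [df Df]; first by move=> x /df/differentiable_continuous.
by split=> // v; apply: IH.
Qed.

(** Includes [h = 0], which matters because one block of a nonzero direction may vanish. *)
Lemma posdefmx_ge0 (R : realType) (n : nat) (A : 'M[R]_n) (h : 'cV[R]_n) :
  posdefmx A -> 0 <= (h^T *m A *m h) 0 0.
Proof.
move=> [_ pA]; have [->|/pA/ltW//] := eqVneq h 0.
by rewrite mulmx0 mxE.
Qed.

(** * Derivatives up to order three and positive definiteness on the product *)

Section ProductDerivatives.
Context (R : realType) (n1 n2 : nat) (w1 w2 : R).
Context (U1 : set 'cV[R]_n1) (U2 : set 'cV[R]_n2).
Context (f1 : 'cV[R]_n1 -> R) (f2 : 'cV[R]_n2 -> R).
Hypotheses (oU1 : open U1) (oU2 : open U2).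
Hypotheses (cf1 : Ck 3 U1 f1) (cf2 : Ck 3 U2 f2).

Let F := prod_fun w1 w2 f1 f2.

Let d1f1 x : U1 x -> differentiable f1 x.
Proof. by case: cf1 => + _; exact. Qed.
Let d1f2 x : U2 x -> differentiable f2 x.
Proof. by case: cf2 => + _; exact. Qed.
Let d2f1 v x : U1 x -> differentiable ('D_v f1) x.
Proof. by case: cf1 => _ /(_ v)[+ _]; exact. Qed.
Let d2f2 v x : U2 x -> differentiable ('D_v f2) x.
Proof. by case: cf2 => _ /(_ v)[+ _]; exact. Qed.
Let d3f1 u v x : U1 x -> differentiable ('D_u ('D_v f1)) x.
Proof. by case: cf1 => _ /(_ v)[_ /(_ u)[+ _]]; exact. Qed.
Let d3f2 u v x : U2 x -> differentiable ('D_u ('D_v f2)) x.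
Proof. by case: cf2 => _ /(_ v)[_ /(_ u)[+ _]]; exact. Qed.

Let derive1F v z : prod_set U1 U2 z ->
  'D_v F z = prod_fun w1 w2 ('D_(usubmx v) f1) ('D_(dsubmx v) f2) z.
Proof. exact: (derive_eq_prod_fun oU1 oU2 d1f1 d1f2 (fun _ _ => erefl)). Qed.

Lemma derive2_prod_fun u v z : prod_set U1 U2 z ->
  'D_u ('D_v F) z = prod_fun w1 w2 ('D_(usubmx u) ('D_(usubmx v) f1))
                                   ('D_(dsubmx u) ('D_(dsubmx v) f2)) z.
Proof.
exact: (derive_eq_prod_fun oU1 oU2 (@d2f1 _) (@d2f2 _) (@derive1F v)).
Qed.

Lemma D1_prod_fun z h : prod_set U1 U2 z ->
  D1 F z h = w1 * D1 f1 (usubmx z) (usubmx h) + w2 * D1 f2 (dsubmx z) (dsubmx h).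
Proof. exact: derive1F. Qed.

Lemma D2_prod_fun z h : prod_set U1 U2 z ->
  D2 F z h = w1 * D2 f1 (usubmx z) (usubmx h) + w2 * D2 f2 (dsubmx z) (dsubmx h).
Proof. exact: derive2_prod_fun. Qed.

Lemma D3_prod_fun z h : prod_set U1 U2 z ->
  D3 F z h = w1 * D3 f1 (usubmx z) (usubmx h) + w2 * D3 f2 (dsubmx z) (dsubmx h).
Proof.
exact: (derive_eq_prod_fun oU1 oU2 (@d3f1 _ _) (@d3f2 _ _)
          (@derive2_prod_fun h h)).
Qed.

(** A nonzero [h] has a nonzero block, which contributes strictly, while the other block contributes
    at least zero. Squaring the averaged first derivative instead of averaging the squares leaves
    the nonnegative surplus [w1 * w2 * (a1 - a2) ^+ 2]. *)
Lemma posdef_prod_fun z : 0 < w1 -> 0 < w2 -> w1 + w2 = 1 ->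
  prod_set U1 U2 z ->
  posdefmx (hessian f1 (usubmx z)
            - gradient f1 (usubmx z) *m (gradient f1 (usubmx z))^T) ->
  posdefmx (hessian f2 (dsubmx z)
            - gradient f2 (dsubmx z) *m (gradient f2 (dsubmx z))^T) ->
  posdefmx (hessian F z - gradient F z *m (gradient F z)^T).
Proof.
move=> w10 w20 w12 Uz pd1 pd2; have [Uz1 Uz2] := Uz.
have [c1 c2] : Ck 2 U1 f1 /\ Ck 2 U2 f2 by split; exact: Ck_pred.
split=> [|h h0].
  (* The rank-one term is symmetric, so only the Hessian has to be checked; its symmetry is
     inherited from the two factors through [derive2C]. *)
  suff hT : (hessian F z)^T = hessian F z by rewrite linearB /= trmx_mul trmxK hT.
  have D2C u v : 'D_u ('D_v F) z = 'D_v ('D_u F) z.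
    have e1 := derive2C oU1 c1 Uz1 (proj1 pd1) (usubmx u) (usubmx v).
    have e2 := derive2C oU2 c2 Uz2 (proj1 pd2) (dsubmx u) (dsubmx v).
    rewrite (derive2_prod_fun u v Uz) (derive2_prod_fun v u Uz).
    exact: (congr2 (fun x y => w1 * x + w2 * y) e1 e2).
  by apply/matrixP => i j; rewrite mxE [LHS]mxE [RHS]mxE; exact: D2C.
rewrite (quad_hessian_sub_gradient _ (open_prod_set oU1 oU2) _ Uz); last first.
  exact: Ck_prod_fun.
rewrite D1_prod_fun// D2_prod_fun//.
have Q1 := @quad_hessian_sub_gradient _ _ _ _ _ (usubmx h) oU1 c1 Uz1.
have Q2 := @quad_hessian_sub_gradient _ _ _ _ _ (dsubmx h) oU2 c2 Uz2.
have P10 := posdefmx_ge0 (usubmx h) pd1.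
have P20 := posdefmx_ge0 (dsubmx h) pd2.
have P12 : 0 < w1 * (D2 f1 (usubmx z) (usubmx h)
                     - D1 f1 (usubmx z) (usubmx h) ^+ 2)
             + w2 * (D2 f2 (dsubmx z) (dsubmx h)
                     - D1 f2 (dsubmx z) (dsubmx h) ^+ 2).
  rewrite -Q1 -Q2; have [h10|h10] := eqVneq (usubmx h) 0.
    rewrite ltr_wpDl ?mulr_ge0 ?(ltW w10)// mulr_gt0//; apply: (proj2 pd2).
    by apply: contra_neq h0 => h20; rewrite -[h]vsubmxK h10 h20 col_mx0.
  by rewrite ltr_pwDl ?mulr_ge0 ?(ltW w20)// mulr_gt0//; apply: (proj2 pd1).
apply: (lt_le_trans P12); rewrite -subr_ge0.
set a1 := D1 f1 _ _; set a2 := D1 f2 _ _.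
rewrite (_ : _ - _ = w1 * w2 * (a1 - a2) ^+ 2).
  by rewrite mulr_ge0 ?sqr_ge0// mulr_ge0// ltW.
have -> : w2 = 1 - w1 by rewrite -w12 addrC addKr.
by ring.
Qed.

End ProductDerivatives.

(** * The self-concordance inequality for the weighted sum *)

Lemma powR_3_2 (R : realType) (x : R) : 0 <= x -> x `^ (3 / 2) = Num.sqrt x ^+ 3.
Proof.
by move=> x0; rewrite mulrC powRrM powR12_sqrt// powR_mulrn// sqrtr_ge0.
Qed.

(** The scalars [a_i], [A_i], [T_i] stand for the first, second and third derivatives of [f_i] along
    a direction. After the change of variables [s_i = sqrt (nu_i - 1)],
    [p_i = sqrt (A_i - a_i ^+ 2)], this is [cubic_product_norm_le]. *)
Lemma psc_ineq_prod (R : realType) (nu1 nu2 w1 w2 a1 a2 A1 A2 T1 T2 : R) :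
  2 <= nu1 -> 2 <= nu2 -> 0 <= w1 -> 0 <= w2 ->
  w1 * (nu1 + nu2) = nu1 -> w2 * (nu1 + nu2) = nu2 ->
  0 <= A1 - a1 ^+ 2 -> 0 <= A2 - a2 ^+ 2 ->
  `|T1 - 6 * A1 * a1 + 4 * a1 ^+ 3|
    <= 2 * ((nu1 - 2) / Num.sqrt (nu1 - 1)) * (A1 - a1 ^+ 2) `^ (3 / 2) ->
  `|T2 - 6 * A2 * a2 + 4 * a2 ^+ 3|
    <= 2 * ((nu2 - 2) / Num.sqrt (nu2 - 1)) * (A2 - a2 ^+ 2) `^ (3 / 2) ->
  `|(w1 * T1 + w2 * T2) - 6 * (w1 * A1 + w2 * A2) * (w1 * a1 + w2 * a2)
      + 4 * (w1 * a1 + w2 * a2) ^+ 3|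
    <= 2 * ((nu1 + nu2 - 2) / Num.sqrt (nu1 + nu2 - 1))
       * ((w1 * A1 + w2 * A2) - (w1 * a1 + w2 * a2) ^+ 2) `^ (3 / 2).
Proof.
move=> hnu1 hnu2 w10 w20 wnu1 wnu2 P10 P20.
rewrite (powR_3_2 P10) (powR_3_2 P20) => b1 b2.
have nup : nu1 + nu2 != 0 by rewrite gt_eqF//; lra.
have w12 : w1 + w2 = 1 by apply: (mulIf nup); rewrite mulrDl wnu1 wnu2 mul1r.
have w2E : w2 = 1 - w1 by rewrite -w12 addrC addKr.
set a := w1 * a1 + w2 * a2; set A := w1 * A1 + w2 * A2.
have PE : A - a ^+ 2 = w1 * (A1 - a1 ^+ 2) + w2 * (A2 - a2 ^+ 2)
                       + w1 * w2 * (a1 - a2) ^+ 2.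
  by rewrite /A /a w2E; ring.
have P0 : 0 <= A - a ^+ 2.
  rewrite PE; apply: addr_ge0; first by apply: addr_ge0; exact: mulr_ge0.
  by rewrite mulr_ge0 ?sqr_ge0// mulr_ge0.
rewrite (powR_3_2 P0).
set p1 := Num.sqrt (A1 - _) in b1; set p2 := Num.sqrt (A2 - _) in b2.
set p := Num.sqrt (A - _).
set s1 := Num.sqrt (nu1 - 1) in b1; set s2 := Num.sqrt (nu2 - 1) in b2.
set s := Num.sqrt (_ - 1).
have p1E : p1 ^+ 2 = A1 - a1 ^+ 2 by rewrite sqr_sqrtr.
have p2E : p2 ^+ 2 = A2 - a2 ^+ 2 by rewrite sqr_sqrtr.
have pE : p ^+ 2 = A - a ^+ 2 by rewrite sqr_sqrtr.
have s1E : s1 ^+ 2 = nu1 - 1 by rewrite sqr_sqrtr//; lra.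
have s2E : s2 ^+ 2 = nu2 - 1 by rewrite sqr_sqrtr//; lra.
have sE : s ^+ 2 = nu1 + nu2 - 1 by rewrite sqr_sqrtr//; lra.
have s10 : 0 < s1 by rewrite sqrtr_gt0; lra.
have s20 : 0 < s2 by rewrite sqrtr_gt0; lra.
have s0 : 0 < s by rewrite sqrtr_gt0; lra.
(* The barrier parameter takes the form [t - t^-1] used in the cubic estimates. *)
have gammaE (t nu : R) : 0 < t -> t ^+ 2 = nu - 1 -> (nu - 2) / t = t - t^-1.
  move=> t0 tE; have -> : nu - 2 = t ^+ 2 - 1 by rewrite tE; ring.
  by field; rewrite gt_eqF.
rewrite (gammaE _ _ s10 s1E) in b1; rewrite (gammaE _ _ s20 s2E) in b2.
rewrite (gammaE _ _ s0 sE).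
(* The factor 2 in the barrier inequality is absorbed by working with half of each cubic form. *)
have halve (E g q : R) : `|E| <= 2 * g * q -> `|E / 2| <= g * q.
  by rewrite normrM (@ger0_norm _ 2^-1)// => ?; lra.
have ws1 : w1 * (s ^+ 2 + 1) = s1 ^+ 2 + 1.
  by rewrite s1E sE !subrK.
have ws2 : w2 * (s ^+ 2 + 1) = s2 ^+ 2 + 1.
  by rewrite s2E sE !subrK.
have := @cubic_product_norm_le R w1 w2 s1 s2 s p1 p2 p (a1 - a2) _ _ w10 w20
  w12 s10 s20 s0 ws1 ws2 (sqrtr_ge0 _) (sqrtr_ge0 _) (sqrtr_ge0 _) _
  (halve _ _ _ b1) (halve _ _ _ b2).
rewrite p1E p2E pE => /(_ PE) h.
have -> : w1 * T1 + w2 * T2 - 6 * A * a + 4 * a ^+ 3 =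
  2 * (w1 * ((T1 - 6 * A1 * a1 + 4 * a1 ^+ 3) / 2) +
       w2 * ((T2 - 6 * A2 * a2 + 4 * a2 ^+ 3) / 2) +
       3 * (w1 * w2 * (a1 - a2) * (A1 - a1 ^+ 2 - (A2 - a2 ^+ 2))) +
       w1 * w2 * (w2 - w1) * (a1 - a2) ^+ 3).
  by rewrite /A /a w2E; field.
by rewrite normrM ger0_norm// -[leRHS]mulrA ler_pM2l.
Qed.

(** * Behaviour at the boundary *)

(** At an interior limit, continuity bounds [f] below by [f p - 1]; at a boundary limit, [f]
    diverges and 0 is a bound. This keeps one summand from cancelling the divergence of the
    other. *)
Lemma psc_barrier_lower_bound (R : realType) (n : nat) (X : set 'cV[R]_n)
    (gamma : R) (f : 'cV[R]_n -> R) (u : nat -> 'cV[R]_n) (p : 'cV[R]_n) :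
  psc_barrier X gamma f -> (forall k, interior X (u k)) -> X p ->
  u k @[k --> \oo] --> p -> exists m, \forall k \near \oo, m <= f (u k).
Proof.
move=> hf Xu Xp up; have [Xop|nXop] := pselect (interior X p).
  have [df _] := psc_C3 hf.
  have fu : f (u k) @[k --> \oo] --> f p.
    exact: (cvg_comp _ _ up (differentiable_continuous (df _ Xop))).
  by exists (f p - 1); apply: (cvgr_ge _ fu); rewrite ltrBlDr ltrDl.
have bp : boundary X p by split => //; exact: subset_closure.
by exists 0; have /cvgryPge := psc_boundary hf Xu bp up; exact.
Qed.

Lemma cvgry_linear_comb (R : realType) (a b m : R) (u v : nat -> R) :
  0 < a -> 0 <= b -> u k @[k --> \oo] --> +oo ->
  (\forall k \near \oo, m <= v k) -> a * u k + b * v k @[k --> \oo] --> +oo.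
Proof.
move=> a0 b0 /cvgryPge uoo mv; apply/cvgryPge => A.
near=> k.
(* This threshold makes [a * u k] exceed [A] even after the worst contribution [b * m] of the second
   term. *)
have : (A - b * m) / a <= u k by near: k; exact: uoo.
rewrite ler_pdivrMr// mulrC => h1.
have : b * m <= b * v k by apply: ler_wpM2l => //; near: k.
by lra.
Unshelve. all: by end_near. Qed.

Theorem mainTheorem8 (R : realType) (n1 n2 : nat)
    (X1 : set 'cV[R]_n1) (X2 : set 'cV[R]_n2)
    (hX1 : regular_convex X1) (hX2 : regular_convex X2)
    (nu1 nu2 : R) (hnu1 : 2 <= nu1) (hnu2 : 2 <= nu2)
    (f1 : 'cV[R]_n1 -> R) (f2 : 'cV[R]_n2 -> R)
    (hf1 : psc_barrier X1 ((nu1 - 2) / Num.sqrt (nu1 - 1)) f1)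
    (hf2 : psc_barrier X2 ((nu2 - 2) / Num.sqrt (nu2 - 1)) f2) :
  psc_barrier (prod_set X1 X2)
    ((nu1 + nu2 - 2) / Num.sqrt (nu1 + nu2 - 1))
    (fun z : 'cV[R]_(n1 + n2) =>
       (nu1 * f1 (usubmx z) + nu2 * f2 (dsubmx z)) / (nu1 + nu2)).
Proof.
have [nu1p nu2p nup] : [/\ 0 < nu1, 0 < nu2 & 0 < nu1 + nu2] by split; lra.
set w1 := nu1 / (nu1 + nu2); set w2 := nu2 / (nu1 + nu2).
have w10 : 0 < w1 by rewrite divr_gt0.
have w20 : 0 < w2 by rewrite divr_gt0.
have w12 : w1 + w2 = 1 by rewrite -mulrDl divff// gt_eqF.
rewrite (_ : (fun z => _) = prod_fun w1 w2 f1 f2); last first.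
  by apply/funext => z; rewrite /prod_fun /w1 /w2; field; rewrite gt_eqF.
have oX1 := @open_interior _ X1; have oX2 := @open_interior _ X2.
have c1 := psc_C3 hf1; have c2 := psc_C3 hf2.
split.
- exact: regular_convex_prod_set.
- by rewrite divr_ge0 ?sqrtr_ge0//; lra.
- by rewrite interior_prod_set; exact: Ck_prod_fun.
- rewrite interior_prod_set => z Xz; have [Xz1 Xz2] := Xz.
  by apply: (posdef_prod_fun oX1 oX2) => //;
    [exact: psc_posdef hf1 _ _|exact: psc_posdef hf2 _ _].
- rewrite /boundary interior_prod_set => u p Xu [clp nXp] up.
  have [X1p X2p] : prod_set X1 X2 p.
    move: clp; rewrite -(proj1 (closure_id _))//.
    by case: (regular_convex_prod_set hX1 hX2).
  have u1p : usubmx (u k) @[k --> \oo] --> usubmx p.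
    exact: (cvg_comp _ _ up (@continuous_usubmx _ _ _ _ p)).
  have u2p : dsubmx (u k) @[k --> \oo] --> dsubmx p.
    exact: (cvg_comp _ _ up (@continuous_dsubmx _ _ _ _ p)).
  have Xu1 k : interior X1 (usubmx (u k)) by case: (Xu k).
  have Xu2 k : interior X2 (dsubmx (u k)) by case: (Xu k).
  have [m1 f1m] := psc_barrier_lower_bound hf1 Xu1 X1p u1p.
  have [m2 f2m] := psc_barrier_lower_bound hf2 Xu2 X2p u2p.
  (* Since [p] is not interior to the product, at least one of its blocks is a boundary point of its
     factor. The barrier there diverges while the other stays bounded below; the sum is commuted
     when the second one diverges. *)
  have [X1op|nX1op] := pselect (interior X1 (usubmx p)).
    rewrite /prod_fun; under eq_fun do rewrite addrC.
    apply: cvgry_linear_comb f1m => //; first exact: ltW.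
    apply: (psc_boundary hf2 Xu2 _ u2p); split; first exact: subset_closure.
    by move=> X2op; apply: nXp.
  apply: cvgry_linear_comb f2m => //; first exact: ltW.
  by apply: (psc_boundary hf1 Xu1 _ u1p); split; first exact: subset_closure.
- rewrite interior_prod_set => z h Xz; have [Xz1 Xz2] := Xz.
  rewrite (D1_prod_fun w1 w2 oX1 oX2 c1 c2 h Xz)
    (D2_prod_fun w1 w2 oX1 oX2 c1 c2 h Xz)
    (D3_prod_fun w1 w2 oX1 oX2 c1 c2 h Xz).
  apply: psc_ineq_prod => //;
    [exact: ltW|exact: ltW| | | | |exact: psc_ineq hf1 _ _ _|exact: psc_ineq hf2 _ _ _].
  + by rewrite divfK// gt_eqF.
  + by rewrite divfK// gt_eqF.
  + rewrite -(quad_hessian_sub_gradient _ oX1 (Ck_pred c1) Xz1).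
    exact/posdefmx_ge0/(psc_posdef hf1).
  + rewrite -(quad_hessian_sub_gradient _ oX2 (Ck_pred c2) Xz2).
  exact/posdefmx_ge0/(psc_posdef hf2).
Qed.
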